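(* Let $n\ge 4$ be an even integer and let $\lambda,a,b>0$ be fixed real numbers. Let $\Lambda=\{\lambda,-a\pm bi,\ldots,-a\pm bi\}$ be the list consisting of $\lambda$ and of $\frac{n-2}{2}$ copies of the conjugate pair $-a+bi,-a-bi$, and suppose $s_1(\Lambda)=\lambda-(n-2)a>0$. If $$\frac{(2n-11)a^2+b^2}{2a}\le\lambda,$$ and there is a real number $c>0$ such that $$\frac{2a(na-\lambda)+b^2-7a^2}{\lambda-(n-2)a}\le c\le\lambda-(n-2)a,$$ then the list of $n$ numbers $$\Lambda_c=\{\lambda,-c,\underbrace{-a\pm bi,\ldots,-a\pm bi}_{n-2\text{ complex numbers}}\}$$ is universally realizable.
   Context: Lists are multisets of complex numbers (repetitions allowed), and $s_1(\Lambda)$ denotes the sum of the elements of $\Lambda$. A Jordan canonical form allowed by a list $\Lambda$ of $n$ complex numbers is a Jordan matrix with spectrum $\Lambda$ (with algebraic multiplicity) that is the Jordan canonical form of some real matrix (i.e. the blocks for non-real eigenvalues occur in conjugate pairs of equal sizes). $\Lambda$ is universally realizable if for every Jordan canonical form $\mathbf{J}$ allowed by $\Lambda$ there is an entrywise nonnegative $n\times n$ matrix with Jordan canonical form $\mathbf{J}$ (up to permutation of blocks). *)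

(* Defs.v *)
From mathcomp Require Import all_boot all_order all_algebra.
From mathcomp Require Import mxred.
From mathcomp Require Import reals.
From mathcomp Require Import complex.

Set Implicit Arguments.
Unset Strict Implicit.
Unset Printing Implicit Defensive.

Import Order.TTheory GRing.Theory Num.Theory.

Local Open Scope ring_scope.
Local Open Scope complex_scope.

Definition jordan_block (F : fieldType) (k : nat) (z : F) : 'M[F]_k :=
  \matrix_(i < k, j < k)
    (if i == j then z else if j == i.+1 :> nat then 1 else 0).

(* The cast only identifies the sum of the block sizes with n. *)
Definition is_jordan_mx (F : fieldType) (n : nat) (J : 'M[F]_n) : Prop :=
  exists (m : nat) (p_ : 'I_m -> nat) (z : 'I_m -> F)
         (eq_n : (\sum_(i < m) p_ i)%N = n),
    (forall i, (0 < p_ i)%N) /\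
    J = castmx (eq_n, eq_n) (\mxdiag_(i < m) jordan_block (p_ i) (z i)).

(* Since the order of the blocks in J is arbitrary, this is "J is the Jordan
   canonical form of A, up to permutation of blocks". *)
Definition has_jordan_form (F : fieldType) (n : nat) (A J : 'M[F]_n) : Prop :=
  is_jordan_mx J /\ similar_in unitmx A J.

Definition has_spectrum (F : fieldType) (n : nat) (A : 'M[F]_n) (L : seq F) :
  Prop := char_poly A = \prod_(z <- L) ('X - z%:P).

Definition complexify (R : realType) (n : nat) (A : 'M[R]_n) : 'M[R[i]]_n :=
  map_mx (real_complex R) A.

Definition jordan_form_allowed (R : realType) (L : seq R[i])
    (J : 'M[R[i]]_(size L)) : Prop :=
  [/\ is_jordan_mx J,
      has_spectrum J L
    & exists A : 'M[R]_(size L), has_jordan_form (complexify A) J].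

Definition nonnegative_mx (R : realType) (n : nat) (A : 'M[R]_n) : Prop :=
  forall i j, 0 <= A i j.

Definition universally_realizable (R : realType) (L : seq R[i]) : Prop :=
  forall J : 'M[R[i]]_(size L), jordan_form_allowed J ->
    exists A : 'M[R]_(size L),
      nonnegative_mx A /\ has_jordan_form (complexify A) J.

Definition conj_pairs (R : realType) (m : nat) (a b : R) : seq R[i] :=
  flatten (nseq m [:: (- a) +i* b; (- a) -i* b]).

Definition Lambda (R : realType) (n : nat) (lam a b : R) : seq R[i] :=
  lam%:C :: conj_pairs ((n - 2) %/ 2) a b.

Definition Lambda_c (R : realType) (n : nat) (lam a b c : R) : seq R[i] :=
  lam%:C :: (- c)%:C :: conj_pairs ((n - 2) %/ 2) a b.

(* Positivity of s1 L in the partially ordered field R[i] means that the sum is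
   real and positive. *)
Definition s1 (R : realType) (L : seq R[i]) : R[i] := \sum_(z <- L) z.

(* Main.v *)
Require Import Defs.
From HB Require Import structures.
From mathcomp Require Import all_boot all_order all_algebra.
From mathcomp Require Import mxred reals complex.
From mathcomp Require Import ring lra zify.

(** Put d = a^2 + b^2, q = (X + a)^2 + b^2 = X^2 + 2 a X + d and n = 2 m + 2.
Since lambda and -c are simple in Lambda_c, and since the Jordan blocks of a
real matrix at -a + b i and -a - b i have the same sizes (sizes_conj), an
allowed Jordan form is determined, up to the order of its blocks, by the sizes
k_1, ..., k_s of its blocks at -a + b i, which form a partition of m.  It has
to be realized by a nonnegative matrix similar to the direct sum of (lambda)
and of the companion matrices of q^k_1 (X + c), q^k_2, ..., q^k_s.

This matrix is glued from s nonnegative companion matrices.  Let A be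
nonnegative with a simple eigenvalue r that has nonnegative left and right
eigenvectors, and let A' be of the same kind with eigenvalue r', such that r
occurs on the diagonal of A'.  Replacing this diagonal entry by the whole
matrix A, and spreading the rest of its row and column along the eigenvectors
of A, gives a nonnegative matrix with eigenvalue r' in which all the Jordan
blocks of A' and all those of A other than (r) survive (perron_split_glue).
Start from the companion matrix of (X - r_1) q^k_1 (X + c), then glue in
succession those of (X - r_i) q^k_i, where r_i = r_(i-1) + 2 a k_i.  This
choice of r_i makes r_(i-1) the trace of the i-th companion matrix, which is
its only nonzero diagonal entry, and the last r_i is lambda when
r_1 = lambda - 2 a (m - k_1).

What remains is that these companion matrices are nonnegative, that is, that
the nonleading coefficients of the polynomials are nonpositive.  If this holds
for (X - r) g, where g has nonnegative coefficients, then it also holds for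
(X - r - 2 a) q g, provided that d <= 2 a (r + 2 a) (perron_factor_quadM).  So
everything reduces to the case g = 1, which is clear, and to the polynomial
(X - r) q (X + c) for r = lambda - 2 a (m - 1), the smallest root that occurs.
For this r, the lower bound on lambda says that d <= 2 a (r + 2 a), the lower
bound on c says that the coefficient of X^2 of (X - r) q (X + c) is
nonpositive, and the upper bound on c says that so is the coefficient of X^3
(perron_factor_quad_linear).  The other coefficients have the right sign. *)
Set Implicit Arguments.
Unset Strict Implicit.
Unset Printing Implicit Defensive.

Import Order.TTheory GRing.Theory Num.Theory.

Local Open Scope ring_scope.
Local Open Scope complex_scope.

(** * Similarity and direct sums of matrices of arbitrary sizes *)

(** The rectangular witnesses P and Q allow the two sizes to be different terms
for the same number (mxsim_dim), as happens all the time with direct sums; this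
avoids casts. *)
Definition mxsim (F : fieldType) (m n : nat) (A : 'M[F]_m) (B : 'M[F]_n) :=
  exists P : 'M_(m, n), exists Q : 'M_(n, m),
    [/\ P *m Q = 1%:M, Q *m P = 1%:M & A *m P = P *m B].

Section Similarity.
Variable F : fieldType.

Lemma mxsim_refl m (A : 'M[F]_m) : mxsim A A.
Proof. by exists 1%:M, 1%:M; rewrite !mulmx1 mul1mx. Qed.

Lemma mxsim_sym m n (A : 'M[F]_m) (B : 'M[F]_n) : mxsim A B -> mxsim B A.
Proof.
case=> P [Q [PQ QP AP]]; exists Q, P; split=> //.
by rewrite -[RHS]mulmx1 -PQ mulmxA -[Q *m A *m P]mulmxA AP mulmxA QP mul1mx.
Qed.

Lemma mxsim_trans m n p (A : 'M[F]_m) (B : 'M[F]_n) (C : 'M[F]_p) :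
  mxsim A B -> mxsim B C -> mxsim A C.
Proof.
move=> [P [Q [PQ QP AP]]] [P' [Q' [PQ' QP' AP']]].
exists (P *m P'), (Q' *m Q); split.
- by rewrite mulmxA -[P *m P' *m Q']mulmxA PQ' mulmx1.
- by rewrite mulmxA -[Q' *m Q *m P]mulmxA QP mulmx1.
- by rewrite mulmxA AP -mulmxA AP' !mulmxA.
Qed.

Lemma mxsim_dim m n (A : 'M[F]_m) (B : 'M[F]_n) : mxsim A B -> m = n.
Proof.
case=> P [Q [PQ QP _]]; apply/eqP; rewrite eqn_leq.
have Hm : (m <= \rank P)%N by rewrite -{1}(mxrank1 F m) -PQ mxrankM_maxl.
have Hn : (n <= \rank P)%N by rewrite -{1}(mxrank1 F n) -QP mxrankM_maxr.
by rewrite (leq_trans Hm (rank_leq_col P)) (leq_trans Hn (rank_leq_row P)).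
Qed.

Lemma similar_mxsim n (A B : 'M[F]_n) : similar_in unitmx A B <-> mxsim A B.
Proof.
split=> [[P Pu /= /eqP AB]|].
  apply: mxsim_sym; exists P, (invmx P); rewrite mulmxV // mulVmx //.
  by split=> //; rewrite -AB /conjmx pinvmxE // mulmxKV.
move=> /mxsim_sym[P [Q [PQ QP AP]]].
have Pu : P \in unitmx by case: (mulmx1_unit PQ).
exists P => //=; apply/eqP; rewrite /conjmx pinvmxE // -AP.
by rewrite mulmxK.
Qed.

Lemma mxsim_cast m n (e : m = n) (A : 'M[F]_m) : mxsim (castmx (e, e) A) A.
Proof. by case: n / e; rewrite castmx_id; exact: mxsim_refl. Qed.

Lemma mxsim_free n (A : 'M[F]_n) (B : 'M[F]_n) (P : 'M_n) :
  row_free P -> A *m P = P *m B -> mxsim A B.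
Proof.
rewrite row_free_unit => Pu AP; exists P, (invmx P).
by rewrite mulmxV // mulVmx.
Qed.

Lemma mxsim_block m n m' n' (A : 'M[F]_m) (B : 'M[F]_n) (A' : 'M[F]_m')
  (B' : 'M[F]_n') : mxsim A A' -> mxsim B B' ->
  mxsim (block_mx A 0 0 B) (block_mx A' 0 0 B').
Proof.
move=> [P [Q [PQ QP AP]]] [P' [Q' [PQ' QP' AP']]].
exists (block_mx P 0 0 P'), (block_mx Q 0 0 Q').
by rewrite !mulmx_block !mulmx0 !mul0mx !addr0 !add0r PQ QP PQ' QP' AP AP'
  -!scalar_mx_block.
Qed.

Lemma mxsim_blockC m n (A : 'M[F]_m) (B : 'M[F]_n) :
  mxsim (block_mx A 0 0 B) (block_mx B 0 0 A).
Proof.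
exists (block_mx 0 1%:M 1%:M 0), (block_mx 0 1%:M 1%:M 0).
by rewrite !mulmx_block !mulmx0 !mul0mx !addr0 !add0r !mulmx1 !mul1mx
  -!scalar_mx_block.
Qed.

Lemma mxsim_blockA m n p (A : 'M[F]_m) (B : 'M[F]_n) (C : 'M[F]_p) :
  mxsim (block_mx A 0 0 (block_mx B 0 0 C)) (block_mx (block_mx A 0 0 B) 0 0 C).
Proof.
have := @block_mxA _ _ _ _ _ _ _ A 0 0 0 B 0 0 0 C.
by rewrite !row_mx0 !col_mx0 => ->; apply: mxsim_cast.
Qed.

Lemma mxsim_char_poly m n (A : 'M[F]_m) (B : 'M[F]_n) :
  mxsim A B -> char_poly A = char_poly B.
Proof.
move=> AB; have e := mxsim_dim AB; subst n.
case: AB => P [Q [PQ QP AP]].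
pose p := map_mx polyC P; have pu : \det p != 0.
  rewrite det_map_mx polyC_eq0 -unitfE -unitmxE.
  by case: (mulmx1_unit PQ).
apply: (mulfI pu); rewrite mulrC /char_poly -!det_mulmx; congr (\det _).
rewrite mulmxBl mulmxBr mul_scalar_mx mul_mx_scalar; congr (_ - _).
by rewrite -!map_mxM AP.
Qed.

Lemma mxsim_rank_exp m n (A : 'M[F]_m) (B : 'M[F]_n) z k :
  mxsim A B -> \rank ((A - z%:M) ^+ k) = \rank ((B - z%:M) ^+ k).
Proof.
have le m' n' (A' : 'M[F]_m') (B' : 'M[F]_n') : mxsim A' B' ->
    (\rank ((A' - z%:M) ^+ k) <= \rank ((B' - z%:M) ^+ k))%N.
  case=> P [Q [PQ QP AP]].
  have APk : (A' - z%:M) ^+ k *m P = P *m (B' - z%:M) ^+ k.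
    elim: k => [|k IHk]; first by rewrite !expr0 mul1mx mulmx1.
    rewrite exprSr -mulmxE -mulmxA mulmxBl AP mul_scalar_mx -mul_mx_scalar.
    by rewrite -mulmxBr mulmxA IHk exprSr -mulmxE mulmxA.
  have -> : (A' - z%:M) ^+ k = P *m (B' - z%:M) ^+ k *m Q.
    by rewrite -APk -mulmxA PQ mulmx1.
  by apply: leq_trans (mxrankM_maxl _ _) (mxrankM_maxr _ _).
by move=> AB; apply/eqP; rewrite eqn_leq !le //; apply: mxsim_sym.
Qed.

(** Packing a matrix with its size allows direct sums to be taken over lists,
with commutativity and associativity free of casts. *)
Definition sqmx : Type := {n : nat & 'M[F]_n}.
Definition sqmx_of n (A : 'M[F]_n) : sqmx := existT _ n A.
Definition sqsim (x y : sqmx) := mxsim (projT2 x) (projT2 y).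

Definition dsum2 (x y : sqmx) : sqmx :=
  sqmx_of (block_mx (projT2 x) 0 0 (projT2 y)).
Definition dsum (s : seq sqmx) : sqmx := foldr dsum2 (sqmx_of (0 : 'M_0)) s.

Lemma sqsim_refl x : sqsim x x. Proof. exact: mxsim_refl. Qed.
Lemma sqsim_sym x y : sqsim x y -> sqsim y x. Proof. exact: mxsim_sym. Qed.
Lemma sqsim_trans y x z : sqsim x y -> sqsim y z -> sqsim x z.
Proof. exact: mxsim_trans. Qed.

Lemma dsum2_sim x y x' y' : sqsim x x' -> sqsim y y' ->
  sqsim (dsum2 x y) (dsum2 x' y').
Proof. exact: mxsim_block. Qed.

Lemma dsum2C x y : sqsim (dsum2 x y) (dsum2 y x).
Proof. exact: mxsim_blockC. Qed.

Lemma dsum2A x y z : sqsim (dsum2 x (dsum2 y z)) (dsum2 (dsum2 x y) z).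
Proof. exact: mxsim_blockA. Qed.

Lemma dsum20 x : sqsim x (dsum2 x (sqmx_of (0 : 'M_0))).
Proof.
case: x => n A; exists (row_mx 1%:M 0), (col_mx 1%:M 0) => /=.
rewrite mul_row_col mul_col_row mul_row_block mul_mx_row.
rewrite !(mulmx1, mul1mx, mul0mx, mulmx0, addr0); split=> //.
rewrite (scalar_mx_block n 0); congr block_mx.
by rewrite [RHS]flatmx0.
Qed.

Lemma dsum_cat s t : sqsim (dsum (s ++ t)) (dsum2 (dsum s) (dsum t)).
Proof.
elim: s => [|x s IHs] /=.
  exact: sqsim_trans (dsum20 _) (dsum2C _ _).
exact: sqsim_trans (dsum2_sim (sqsim_refl _) IHs) (dsum2A _ _ _).
Qed.

Lemma dsum_catC s t : sqsim (dsum (s ++ t)) (dsum (t ++ s)).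
Proof.
apply: sqsim_trans (dsum_cat _ _) _; apply: sqsim_trans (dsum2C _ _) _.
exact/sqsim_sym/dsum_cat.
Qed.

Lemma dsum_cons x s t : sqsim (dsum s) (dsum t) -> sqsim (dsum (x :: s)) (dsum (x :: t)).
Proof. exact: dsum2_sim (sqsim_refl _). Qed.

Lemma dsum_map_perm (T : eqType) (f : T -> sqmx) s t : perm_eq s t ->
  sqsim (dsum (map f s)) (dsum (map f t)).
Proof.
elim: s t => [|x s IHs] t.
  by rewrite perm_sym => /perm_nilP->; apply: sqsim_refl.
move=> st; have xt : x \in t by rewrite -(perm_mem st) mem_head.
case/splitPr: xt st => t1 t2; rewrite perm_sym -cat1s perm_catCA /= perm_cons.
rewrite perm_sym => /IHs st; apply: sqsim_trans (dsum_cons _ st) _.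
rewrite !map_cat /=; apply: sqsim_trans _ (dsum_catC (_ :: _) _).
exact/dsum_cons/dsum_catC.
Qed.

Lemma dsum_map_sim (T : eqType) (f g : T -> sqmx) s :
  {in s, forall x, sqsim (f x) (g x)} -> sqsim (dsum (map f s)) (dsum (map g s)).
Proof.
elim: s => [|x s IHs] fg /=; first exact: sqsim_refl.
apply: dsum2_sim; first by apply: fg; rewrite mem_head.
by apply: IHs => y ys; apply: fg; rewrite inE ys orbT.
Qed.

Lemma dsum_flatten ss : sqsim (dsum (flatten ss)) (dsum (map dsum ss)).
Proof.
elim: ss => [|s ss IHss] /=; first exact: sqsim_refl.
exact: sqsim_trans (dsum_cat _ _) (dsum2_sim (sqsim_refl _) IHss).
Qed.

Lemma foldr_dsum2 (x : sqmx) s : sqsim (foldr dsum2 x s) (dsum (x :: s)).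
Proof.
apply: sqsim_trans (dsum_catC s [:: x]).
elim: s => [|y s IHs] /=; first exact: dsum20.
exact: dsum2_sim (sqsim_refl _) IHs.
Qed.

Lemma mxdiag_dsum m (p_ : 'I_m -> nat) (B : forall i, 'M[F]_(p_ i)) :
  sqsim (sqmx_of (\mxdiag_i B i)) (dsum [seq sqmx_of (B i) | i <- enum 'I_m]).
Proof.
elim: m p_ B => [|m IHm] p_ B.
  rewrite (_ : enum _ = [::]); last by apply: size0nil; rewrite size_enum_ord.
  rewrite /= /sqsim /=.
  have e : (\sum_(i < 0) p_ i)%N = 0%N by rewrite big_ord0.
  apply: mxsim_trans (mxsim_sym (mxsim_cast e _)) _.
  by rewrite [castmx _ _]flatmx0; apply: mxsim_refl.
rewrite enum_ordSl /= -map_comp.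
rewrite /sqsim /= mxdiag_recl; apply: mxsim_trans (mxsim_cast _ _) _.
exact: mxsim_block (mxsim_refl _) (IHm _ _).
Qed.

End Similarity.

(** * Companion matrices *)
Section Companion.
Variable F : fieldType.
Implicit Types (f g : {poly F} -> {poly F}) (p q r : {poly F}).

(** Row vectors of length n stand for the polynomials of size at most n.  When f
is linear, polymx m n f is its matrix between two such spaces, so that identities
between matrices become identities between polynomials (polymxM). *)
Definition polymx m n f : 'M[F]_(m, n) := \matrix_i poly_rV (f 'X^i).

Lemma polymx_mul m n f (u : 'rV_m) : linear f ->
  u *m polymx m n f = poly_rV (f (rVpoly u)).
Proof.
move=> lf; pose fl := GRing.isLinear.Build _ _ _ _ f lf.
pose f' : {linear {poly F} -> {poly F}} := HB.pack f fl.
rewrite mulmx_sum_row [X in rVpoly X]row_sum_delta.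
rewrite -[f _]/(f' _) !linear_sum /=.
apply: eq_bigr => i _; rewrite rowK -[f _]/(f' _) -[f (_ _)]/(f' _).
by rewrite !linearZ /= rVpoly_delta.
Qed.

Lemma eq_polymx m n f g : (forall i, (i < m)%N -> f 'X^i = g 'X^i) ->
  polymx m n f = polymx m n g.
Proof. by move=> fg; apply/matrixP => i j; rewrite !mxE fg. Qed.

Lemma polymxM m n k f g : linear g ->
  (forall i, (i < m)%N -> (size (f 'X^i) <= n)%N) ->
  polymx m n f *m polymx n k g = polymx m k (g \o f).
Proof.
move=> lg sf; apply/row_matrixP => i.
by rewrite row_mul !rowK polymx_mul // poly_rV_K ?sf.
Qed.

Lemma polymx_free n f : linear f ->
  (forall r, (size r <= n)%N -> (size (f r) <= n)%N) ->
  (forall r, (size r <= n)%N -> f r = 0 -> r = 0) ->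
  row_free (polymx n n f).
Proof.
move=> lf sf inj; apply: inj_row_free => u; rewrite polymx_mul // => u0.
have su : (size (rVpoly u) <= n)%N by apply: size_poly.
have := congr1 rVpoly u0; rewrite poly_rV_K ?sf // linear0 => /inj.
by move=> /(_ su) /(congr1 (@poly_rV F n)); rewrite rVpolyK linear0.
Qed.

Lemma linear_modp p : linear (fun r => r %% p).
Proof. by move=> a u v; rewrite modpD modpZl. Qed.

(** The matrix of the multiplication by X on F[X]/(p) when p has size n.+1.  The
size is a separate parameter, so that it can be given the shape that a block
decomposition requires. *)
Definition companion n p : 'M[F]_n := polymx n n (fun r => ('X * r) %% p).

Lemma linear_mulX_modp p : linear (fun r => ('X * r) %% p).
Proof. by move=> a u v; rewrite mulrDr modpD -scalerAr modpZl. Qed.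

Lemma size_modp_le n p r : size p = n.+1 -> (size (r %% p)%R <= n)%N.
Proof. by move=> sp; rewrite -ltnS -sp ltn_modp -size_poly_gt0 sp. Qed.

Lemma companionE n p (i j : 'I_n) : p \is monic -> size p = n.+1 ->
  companion n p i j = if i.+1 == n then - p`_j else (j == i.+1 :> nat)%:R.
Proof.
move=> mp sp; rewrite !mxE -exprS; case: eqP => [ein|/eqP nin].
  have -> : 'X^(i.+1) %% p = 'X^(i.+1) - p :> {poly F}.
    rewrite -[X in X %% p](subrK p) modpD modpp addr0 modp_small // ein.
    rewrite sp ltnS; apply/leq_sizeP => k le_nk; rewrite coefB coefXn.
    have := le_nk; rewrite leq_eqVlt => /predU1P[<-|lt_nk].
      by move/monicP: mp; rewrite /lead_coef sp eqxx /= => ->; rewrite subrr.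
    by rewrite gtn_eqF // nth_default ?subr0 // sp.
  by rewrite coefB coefXn ein ltn_eqF // sub0r.
rewrite modp_small ?coefXn // size_polyXn sp !ltnS.
by rewrite ltn_neqAle nin ltn_ord.
Qed.

Lemma modp_modp_dvd p q r : q %| p -> (r %% p) %% q = r %% q.
Proof.
move=> qp; rewrite [in RHS](divp_eq r p) modpD.
by rewrite (_ : (_ * p) %% q = 0) ?add0r //; apply/modp_eq0P/dvdp_mull.
Qed.

Lemma companion_mul_modp n k p q : size p = n.+1 -> size q = k.+1 -> q %| p ->
  companion n p *m polymx n k (fun r => r %% q) =
  polymx n k (fun r => r %% q) *m companion k q.
Proof.
move=> sp szq qp; rewrite (polymxM _ (linear_modp q)); last first.
  by move=> i _; apply: size_modp_le.
rewrite (polymxM _ (linear_mulX_modp q)); last first.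
  by move=> i _; apply: size_modp_le.
by apply: eq_polymx => i _ /=; rewrite modp_modp_dvd // modp_mul.
Qed.

(** The matrix of the map from F[X]/(p q) to F[X]/(p) x F[X]/(q). *)
Definition crtmx m n p q : 'M[F]_(m + n) :=
  row_mx (polymx (m + n) m (fun r => r %% p)) (polymx (m + n) n (fun r => r %% q)).

Lemma companion_mul_crtmx m n p q : size p = m.+1 -> size q = n.+1 ->
  companion (m + n) (p * q) *m crtmx m n p q =
  crtmx m n p q *m block_mx (companion m p) 0 0 (companion n q).
Proof.
move=> sp szq; have spq : size (p * q) = (m + n).+1.
  by rewrite size_mul -?size_poly_gt0 ?sp ?szq // addnS.
rewrite mul_mx_row mul_row_block !mulmx0 addr0 add0r.
by rewrite !(companion_mul_modp spq) // ?dvdp_mulIl ?dvdp_mulIr.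
Qed.

(** A polynomial in the kernel is divisible by the coprime p and q, hence by
p q, whose size is too large unless the polynomial is zero. *)
Lemma crtmx_free m n p q : size p = m.+1 -> size q = n.+1 -> coprimep p q ->
  row_free (crtmx m n p q).
Proof.
move=> sp szq cpq; apply: inj_row_free => u; rewrite mul_mx_row -row_mx0.
case/eq_row_mx; rewrite !polymx_mul; try exact: linear_modp.
set r := rVpoly u => /(congr1 rVpoly); rewrite linear0 poly_rV_K ?(size_modp_le _ sp) //.
move=> /eqP pr /(congr1 rVpoly); rewrite linear0 poly_rV_K ?(size_modp_le _ szq) //.
move=> /eqP qr.
have : p * q %| r by rewrite Gauss_dvdp //; apply/andP; split.
move=> pqr; have r0 : r = 0.
  apply/eqP/contraT => r0; have := dvdp_leq r0 pqr.
  rewrite size_mul -?size_poly_gt0 ?sp ?szq // addSn addnS /=.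
  by rewrite ltnNge size_poly.
by rewrite -[u]rVpolyK -/r r0 linear0 row_mx0.
Qed.

Lemma mxsim_crt m n p q : size p = m.+1 -> size q = n.+1 -> coprimep p q ->
  mxsim (companion (m + n) (p * q)) (block_mx (companion m p) 0 0 (companion n q)).
Proof.
move=> sp szq cpq; apply: (mxsim_free (crtmx_free sp szq cpq)).
exact: companion_mul_crtmx.
Qed.

(** The Jordan block is the multiplication by X + z on F[X]/(X^k) in the basis of
the powers of X. *)
Lemma jordan_blockE k (z : F) :
  jordan_block k z = polymx k k (fun r => (('X + z%:P) * r) %% 'X^k).
Proof.
apply/matrixP => i j; rewrite !mxE mulrDl -exprS modpD coefD mul_polyC modpZl.
have -> : 'X^i %% 'X^k = 'X^i :> {poly F} by rewrite modp_small ?size_polyXn ?ltnS.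
rewrite coefZ coefXn.
have -> : ('X^(i.+1) %% 'X^k : {poly F})`_j = ((j == i.+1 :> nat)%:R : F).
  have [lt_ik|le_ki] := ltnP i.+1 k.
    by rewrite modp_small ?size_polyXn ?ltnS // coefXn.
  have -> : i.+1 = k by apply/eqP; rewrite eqn_leq le_ki ltn_ord.
  by rewrite modpp coef0 ltn_eqF.
rewrite -val_eqE /= [(j : nat) == i]eq_sym.
case: eqP => [->|_]; last by rewrite mulr0 addr0; case: eqP.
by rewrite mulr1 ltn_eqF ?add0r.
Qed.

(** The substitution of X - z for X carries F[X]/(X^k), with the multiplication
by X + z, to F[X]/((X - z)^k), with the multiplication by X. *)
Lemma companion_jordan k (z : F) :
  mxsim (companion k (('X - z%:P) ^+ k)) (jordan_block k z).
Proof.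
apply: mxsim_sym; rewrite jordan_blockE.
have sX : size ('X - z%:P) = 2%N by rewrite size_XsubC.
have sXk : size (('X - z%:P) ^+ k) = k.+1 by rewrite size_exp_XsubC.
have lc : linear (fun r => r \Po ('X - z%:P)).
  by move=> a u v; rewrite comp_polyD comp_polyZ.
have Pf : row_free (polymx k k (fun r => r \Po ('X - z%:P))).
  apply: polymx_free => // r sr; first by rewrite size_comp_poly2.
  by move=> /eqP; rewrite comp_poly2_eq0 // => /eqP.
apply: (mxsim_free Pf); rewrite (polymxM _ lc); last first.
  by move=> i _; apply: size_modp_le; rewrite size_polyXn.
rewrite (polymxM _ (linear_mulX_modp _)); last first.
  by move=> i ik; rewrite size_comp_poly2 // size_polyXn.
apply: eq_polymx => i ik /=; set r := ('X + _) * _.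
apply: (modpP (q := (r %/ 'X^k) \Po ('X - z%:P))); last first.
  rewrite size_comp_poly2 // sXk ltnS; apply: size_modp_le.
  by rewrite size_polyXn.
rewrite -[X in _ * X + _]comp_Xn_poly -comp_polyM -comp_polyD -divp_eq /r comp_polyM.
by rewrite comp_polyD comp_polyX comp_polyC subrK.
Qed.

End Companion.

(** * Gluing nonnegative matrices at a diagonal entry *)
Section Nonneg.
Variable K : realFieldType.
Implicit Types (g p : {poly K}) (a d r : K).

Definition mx_ge0 m n (A : 'M[K]_(m, n)) := forall i j, 0 <= A i j.

Lemma mulmx_ge0 m n k (A : 'M[K]_(m, n)) (B : 'M[K]_(n, k)) :
  mx_ge0 A -> mx_ge0 B -> mx_ge0 (A *m B).
Proof. by move=> A0 B0 i j; rewrite mxE sumr_ge0 // => l _; apply: mulr_ge0. Qed.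

(** The first column s and the first row t of the change of basis are a right and
a left eigenvector for r, normalized by t s = 1.  They are recorded because
gluing multiplies nonnegative entries by them. *)
Definition perron_split n k (A : 'M[K]_n) r (B : 'M[K]_k) :=
  exists (s : 'cV_n) (t : 'rV_n) (P : 'M_(n, k)) (Q : 'M_(k, n)),
  [/\ mx_ge0 A, mx_ge0 s & mx_ge0 t] /\
  [/\ row_mx s P *m col_mx t Q = 1%:M,
      col_mx t Q *m row_mx s P = 1%:M
    & A *m row_mx s P = row_mx s P *m block_mx r%:M 0 0 B].

Lemma perron_split_mxsim n k (A : 'M[K]_n) r (B : 'M[K]_k) :
  perron_split A r B -> mxsim A (block_mx (r%:M : 'M_1) 0 0 B).
Proof.
by case=> s [t [P [Q [_ [PQ QP AP]]]]]; exists (row_mx s P), (col_mx t Q).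
Qed.

Lemma mx_ge0_block m1 m2 n1 n2 (A : 'M[K]_(m1, n1)) (B : 'M_(m1, n2))
    (C : 'M_(m2, n1)) (D : 'M_(m2, n2)) :
  mx_ge0 A -> mx_ge0 B -> mx_ge0 C -> mx_ge0 D -> mx_ge0 (block_mx A B C D).
Proof.
move=> A0 B0 C0 D0 i j.
by case: (split_ordP i) => {i} i ->; case: (split_ordP j) => {j} j ->;
  rewrite ?(block_mxEul, block_mxEur, block_mxEdl, block_mxEdr).
Qed.

Lemma mx_ge0_blockP m1 m2 n1 n2 (A : 'M[K]_(m1, n1)) (B : 'M_(m1, n2))
    (C : 'M_(m2, n1)) (D : 'M_(m2, n2)) : mx_ge0 (block_mx A B C D) ->
  [/\ mx_ge0 A, mx_ge0 B, mx_ge0 C & mx_ge0 D].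
Proof.
move=> M0; split=> i j.
- by rewrite -(block_mxEul A B C D).
- by rewrite -(block_mxEur A B C D).
- by rewrite -(block_mxEdl A B C D).
- by rewrite -(block_mxEdr A B C D).
Qed.

(** Conjugating the matrix M of the proof by the change of basis [s P] of A,
extended by the identity on the first k coordinates, splits off B: as t and s are
the first row and the first column of the change of basis, the off-diagonal
blocks u t and s v only touch the coordinate of the eigenvalue r.  What is left
on the other coordinates is the second matrix, which is then split as r' and
B'. *)
Lemma perron_split_glue n k m l (A : 'M[K]_n) (B : 'M[K]_l) r
    (A1 : 'M[K]_k) (u : 'cV_k) (v : 'rV_k) (B' : 'M[K]_m) r' :
  perron_split A r B -> perron_split (block_mx A1 u v (r%:M : 'M_1)) r' B' ->
  exists M : 'M[K]_(k + n), perron_split M r' (block_mx B' 0 0 B).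
Proof.
case=> s [t [P [Q [[A0 s0 t0] []]]]].
rewrite mul_row_col mul_col_row mul_mx_row mul_row_block !mulmx0 addr0 add0r.
rewrite mul_mx_scalar (@scalar_mx_block _ 1 l) => PQ.
case/eq_block_mx => ts tP Qs QP /eq_row_mx[As AP].
case=> s' [t' [P' [Q' [[A'0 s'0 t'0]]]]].
move: s'0 t'0; rewrite -[s']vsubmxK -[t']hsubmxK -[P']vsubmxK -[Q']hsubmxK.
move: (usubmx s') (dsubmx s') (lsubmx t') (rsubmx t') (usubmx P') (dsubmx P')
  (lsubmx Q') (rsubmx Q') => s1 s2 t1 t2 P1 P2 Q1 Q2 {s' t' P' Q'} s'0 t'0.
rewrite !(mul_row_col, mul_col_row, mul_mx_row, mul_row_block, mulmx0, addr0, add0r).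
rewrite !add_block_mx !(addr0, add0r) mul_scalar_mx.
rewrite (@scalar_mx_block _ k 1) (@scalar_mx_block _ 1 m) !mul_mx_scalar.
rewrite !mul_scalar_mx => -[].
case/eq_block_mx => E1 E2 E3 E4 /eq_block_mx[F1 F2 F3 F4] /eq_block_mx[G1 G2 G3 G4].
have ts_ w (x : 'M_(1, w)) : t *m (s *m x) = x by rewrite mulmxA ts mul1mx.
have tP_ w (x : 'M_(l, w)) : t *m (P *m x) = 0 by rewrite mulmxA tP mul0mx.
have Qs_ w (x : 'M_(1, w)) : Q *m (s *m x) = 0 by rewrite mulmxA Qs mul0mx.
have [A10 u0 v0 _] := mx_ge0_blockP A'0.
have [s10 s20] : mx_ge0 s1 /\ mx_ge0 s2.
  split=> i j; first by rewrite -(col_mxEu s1 s2).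
  by rewrite -(col_mxEd s1 s2).
have [t10 t20] : mx_ge0 t1 /\ mx_ge0 t2.
  split=> i j; first by rewrite -(row_mxEl t1 t2).
  by rewrite -(row_mxEr t1 t2).
exists (block_mx A1 (u *m t) (s *m v) A).
(* The eigenvectors for r' keep their first k entries, and their last entry is
   spread along s or t. *)
exists (col_mx s1 (s *m s2)), (row_mx t1 (t2 *m t)).
exists (block_mx P1 0 (s *m P2) P), (block_mx Q1 (Q2 *m t) 0 Q).
split.
  split.
  - by apply: mx_ge0_block => //; apply: mulmx_ge0.
  - move=> i j; case: (split_ordP i) => {i} i ->.
      by rewrite col_mxEu.
    by rewrite col_mxEd; apply: mulmx_ge0.
  - move=> i j; case: (split_ordP j) => {j} j ->.
      by rewrite row_mxEl.
    by rewrite row_mxEr; apply: mulmx_ge0.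
split.
- rewrite mul_row_col mul_col_row mulmx_block add_block_mx.
  rewrite !(mulmx0, mul0mx, addr0, add0r) -!mulmxA !(mulmxA s1) !(mulmxA P1).
  rewrite E1 -mulmxDl E2 mul0mx -mulmxDr E3 mulmx0.
  rewrite addrA -mulmxDr !(mulmxA s2) !(mulmxA P2) -mulmxDl E4 mul1mx PQ.
  by rewrite -scalar_mx_block.
- rewrite mul_col_row mulmx_block mul_row_col mul_row_block mul_block_col.
  rewrite !(mulmx0, mul0mx, addr0, add0r) -!mulmxA !(ts_, tP_, Qs_, ts, tP, Qs, QP).
  rewrite !(mulmx0, mul0mx, addr0, add0r) F1 F2 F3 F4 row_mx0 col_mx0.
  by rewrite -!scalar_mx_block.
- rewrite !mul_mx_row mul_row_block !mulmx0 addr0 add0r !mul_mx_scalar.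
  rewrite mul_block_col !mulmx_block !(mulmx0, mul0mx, addr0, add0r) -!mulmxA.
  rewrite !(ts_, tP) !mulmx0 (mulmxA A s) As -scalemxAl scalemxAr (mulmxA A s) As.
  rewrite -scalemxAl scalemxAr -!mulmxDr G1 G2 G3 G4 AP -scalemxAr.
  by rewrite scale_col_mx.
Qed.

Lemma companion_ge0 n p : p \is monic -> size p = n.+1 ->
  (forall i, (i < n)%N -> p`_i <= 0) -> mx_ge0 (companion n p).
Proof.
move=> mp sp p0 i j; rewrite companionE //; case: ifP => _.
  by rewrite oppr_ge0 p0.
exact: ler0n.
Qed.

(** The Chinese remainder matrix for X - r and g has first column (1, r, r^2, ...),
which is the right eigenvector.  A left eigenvector is given by the coefficients
of g, because X g = r g modulo (X - r) g. *)
Lemma companion_perron N n g r : N = n.+1 -> size g = n.+1 ->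
  (forall i, 0 <= g`_i) -> 0 <= r -> 0 < g.[r] ->
  mx_ge0 (companion N (('X - r%:P) * g)) ->
  perron_split (companion N (('X - r%:P) * g)) r (companion n g).
Proof.
move=> eN; subst N => sg g0 r0 gr0 C0.
have sX : size ('X - r%:P) = 2%N by rewrite size_XsubC.
have cXg : coprimep ('X - r%:P) g by rewrite coprimep_sym coprimep_XsubC /root gt_eqF.
have Wf := crtmx_free sX sg cXg; have := companion_mul_crtmx sX sg.
rewrite row_free_unit in Wf; set W := crtmx 1 n _ _ in Wf *.
have -> : companion 1 ('X - r%:P) = r%:M.
  apply/matrixP => i j; rewrite companionE ?monicXsubC // !ord1 /=.
  by rewrite mxE eqxx coefB coefX coefC sub0r opprK.
move=> CW.
(* g is g.[r] modulo X - r and 0 modulo g. *)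
pose t : 'rV[K]_(1 + n) := (g.[r])^-1 *: poly_rV g.
have tW : t *m W = row_mx 1%:M 0.
  rewrite /W /crtmx mul_mx_row; congr row_mx.
    rewrite polymx_mul; last exact: linear_modp.
    rewrite linearZ /= poly_rV_K ?sg // modp_XsubC hornerZ mulVf ?gt_eqF //.
    by apply/matrixP => i j; rewrite !ord1 !mxE coefC.
  rewrite polymx_mul; last exact: linear_modp.
  by rewrite linearZ /= poly_rV_K ?sg // modpZl modpp scaler0 linear0.
have tE : t = usubmx (invmx W).
  rewrite -[t](mulmxK Wf) tW -[X in _ *m X = _](vsubmxK (invmx W)) mul_row_col.
  by rewrite mul1mx mul0mx addr0.
exists (lsubmx W), t, (rsubmx W), (dsubmx (invmx W)).
rewrite tE vsubmxK hsubmxK mulVmx // mulmxV //; split=> //; split=> //.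
  move=> i j; rewrite mxE /W /crtmx row_mxEl !mxE modp_XsubC hornerXn coefC.
  by case: eqP => // _; apply: exprn_ge0.
move=> i j; rewrite -tE !mxE mulr_ge0 // invr_ge0; exact: ltW.
Qed.

(** * Nonnegative companion matrices with a prescribed Perron root *)

(** The signs of the coefficients of (X - r) g make its companion matrix
nonnegative; those of the coefficients of g make its left eigenvector for r
nonnegative. *)
Definition perron_factor g r := [/\ g \is monic, forall i, 0 <= g`_i
  & forall i, (i < size g)%N -> (('X - r%:P) * g)`_i <= 0].

Definition quad a d : {poly K} := 'X^2 + (2 * a) *: 'X + d%:P.

Lemma size_quad a d : size (quad a d) = 3%N.
Proof.
rewrite /quad -addrA size_polyDl ?size_polyXn //.
rewrite (leq_ltn_trans (size_polyD _ _)) // gtn_max.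
rewrite (leq_ltn_trans (size_scale_leq _ _)) ?size_polyX //.
by rewrite (leq_ltn_trans (size_polyC_leq1 _)).
Qed.

Lemma monic_quad a d : quad a d \is monic.
Proof.
rewrite monicE /lead_coef size_quad /quad !coefD coefXn coefZ coefX coefC /=.
by rewrite mulr0 !addr0.
Qed.

Lemma size_quadM a d g : g \is monic -> size (quad a d * g) = (size g).+2.
Proof.
move=> mg; rewrite size_Mmonic ?size_quad //.
by rewrite -size_poly_gt0 size_quad.
Qed.

Lemma quad_coef a d p i : (quad a d * p)`_i =
  (if (1 < i)%N then p`_(i - 2) else 0) +
  2 * a * (if (0 < i)%N then p`_(i.-1) else 0) + d * p`_i.
Proof.
rewrite /quad !mulrDl !coefD coefXnM -scalerAl coefZ coefXM coefCM.
by case: i => [|[|i]] /=; ring.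
Qed.

(** With p = (X - r) g, we have (X - r - 2 a) q g = q p - 2 a q g.  As p is
nonpositive below its leading coefficient and q g is nonnegative, only the two
highest nonleading coefficients can be spoiled, by the leading coefficient of p.
The higher one equals that of p; in the next one, the terms that may be
positive amount, once g is eliminated, to d - 2 a (r + 2 a). *)
Lemma perron_factor_quadM g r a d :
  0 <= a -> 0 <= d -> d <= 2 * a * (r + 2 * a) ->
  perron_factor g r -> perron_factor (quad a d * g) (r + 2 * a) /\
  (('X - (r + 2 * a)%:P) * (quad a d * g))`_(size g).+1 =
  (('X - r%:P) * g)`_(size g).-1.
Proof.
move=> a0 d0 dr [mg g0 p0]; set p := ('X - r%:P) * g.
have [N sg] : exists N, size g = N.+1.
  by exists (size g).-1; rewrite prednK // size_poly_gt0 monic_neq0.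
have sX : size ('X - r%:P) = 2%N by rewrite size_XsubC.
have gN : g`_N = 1 by move/monicP: mg; rewrite /lead_coef sg.
have mp : p \is monic by rewrite monicMl // monicXsubC.
have sp : size p = N.+2.
  by rewrite size_Mmonic ?polyXsubC_eq0 ?sX ?sg // -size_poly_gt0 sX.
have pN : p`_N.+1 = 1 by move/monicP: mp; rewrite /lead_coef sp.
have gbig i : (N < i)%N -> g`_i = 0 by move=> lt; rewrite nth_default // sg.
have pbig i : (N.+1 < i)%N -> p`_i = 0 by move=> lt; rewrite nth_default // sp.
have ple i : (i <= N)%N -> p`_i <= 0 by move=> le; apply: p0; rewrite sg ltnS.
have pE i : p`_i = (if (0 < i)%N then g`_(i.-1) else 0) - r * g`_i.
  by rewrite /p mulrBl coefB coefXM coefCM; case: i.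
have qg0 i : 0 <= (quad a d * g)`_i.
  by rewrite quad_coef !addr_ge0 ?mulr_ge0 ?g0 //; case: ifP.
have E i : (('X - (r + 2 * a)%:P) * (quad a d * g))`_i =
    (quad a d * p)`_i - 2 * a * (quad a d * g)`_i.
  have -> : ('X - (r + 2 * a)%:P) * (quad a d * g) =
      quad a d * p - (2 * a)%:P * (quad a d * g) by rewrite /p polyCD; ring.
  by rewrite coefB coefCM.
rewrite sg.
have corner : (('X - (r + 2 * a)%:P) * (quad a d * g))`_N.+2 = p`_N.
  rewrite E !quad_coef /= !subn2 /= pN gN (pbig N.+2) // (gbig N.+1) // (gbig N.+2) //.
  ring.
split; last by rewrite corner.
split; first by rewrite monicMl // monic_quad.
  exact: qg0.
move=> i; rewrite size_quadM // sg ltnS leq_eqVlt => /predU1P[->|].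
  by rewrite corner ple.
rewrite ltnS leq_eqVlt => /predU1P[->|lti].
  rewrite E !quad_coef /= pN gN (gbig N.+1) // subn2 /=.
  (* The coefficient of X^N in (X - r) g is g_(N-1) - r: this is how r enters. *)
  have := pE N; rewrite gN; case: N {sg gN pN gbig pbig corner sp} ple => [|N] ple /= pEN.
    rewrite pEN; nra.
  by have := ple N (leqnSn _); rewrite pEN; nra.
rewrite E subr_le0; apply: le_trans (_ : 0 <= _); last first.
  by rewrite mulr_ge0 // mulr_ge0.
rewrite quad_coef -oppr_ge0 !opprD -!mulrN !addr_ge0 ?mulr_ge0 ?oppr_ge0 //.
- by case: ifP => // _; rewrite ple // (leq_trans (leq_subr _ _)) // ltnW.
- by case: ifP => // _; rewrite ple // (leq_trans (leq_pred _)) // ltnW.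
- by rewrite ple // ltnW.
Qed.

End Nonneg.

Section Build.
Variable K : realFieldType.
Implicit Types (g p : {poly K}) (a c d r : K).

Lemma perron_factor_horner_gt0 g r x : perron_factor g r -> 0 < x -> 0 < g.[x].
Proof.
case=> mg g0 _ x0; rewrite horner_coef.
have sg : (0 < size g)%N by rewrite size_poly_gt0 monic_neq0.
rewrite -(prednK sg) big_ord_recr /= ltr_wpDl //.
  by rewrite sumr_ge0 // => i _; rewrite mulr_ge0 // exprn_ge0 // ltW.
by move/monicP: mg; rewrite /lead_coef => ->; rewrite mul1r exprn_gt0.
Qed.

Lemma perron_factor_split g r n : perron_factor g r -> 0 < r -> size g = n.+1 ->
  perron_split (companion (n + 1) (('X - r%:P) * g)) r (companion n g).
Proof.
move=> gg r0 sg; have [mg g0 p0] := gg.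
apply: companion_perron; rewrite ?addn1 ?(perron_factor_horner_gt0 gg) ?ltW //.
apply: companion_ge0; first by rewrite monicMl // monicXsubC.
  by rewrite size_Mmonic ?polyXsubC_eq0 ?size_XsubC ?sg // -size_poly_gt0 size_XsubC.
by move=> i; rewrite -sg; apply: p0.
Qed.

(** The coefficient condition says that the last diagonal entry of the companion
matrix of (X - r') g is r, so A can be glued there. *)
Lemma perron_factor_glue N l (A : 'M[K]_N) (B : 'M_l) r g r' n : perron_split A r B ->
  perron_factor g r' -> 0 < r' -> size g = n.+1 -> (('X - r'%:P) * g)`_n = - r ->
  exists N' (M : 'M[K]_N'), perron_split M r' (block_mx (companion n g) 0 0 B).
Proof.
move=> Ar gg r0 sg corner; have := perron_factor_split gg r0 sg.
have [mg _ _] := gg; set C := companion (n + 1) _.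
have Cr : C (rshift n ord0) (rshift n ord0) = r.
  rewrite /C companionE /= ?addn0 ?addn1 ?eqxx ?corner ?opprK //.
    by rewrite monicMl // monicXsubC.
  by rewrite size_Mmonic ?polyXsubC_eq0 ?size_XsubC ?sg // -size_poly_gt0 size_XsubC.
have -> : C = block_mx (ulsubmx C) (ursubmx C) (dlsubmx C) r%:M.
  rewrite -[LHS]submxK; congr block_mx; apply/matrixP => i j.
  by rewrite !ord1 -(block_mxEdr (ulsubmx C) (ursubmx C) (dlsubmx C)) submxK Cr mxE.
by move=> CP; have [M ?] := perron_split_glue Ar CP; exists (n + N)%N, M.
Qed.

(** The last component says that the trace of the companion matrix of (X - r) g
is preserved: each factor q adds 2 a to the root and the pair -a + b i, -a - b i
to the spectrum. *)
Lemma perron_factor_quad_exp g r a d k :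
  0 <= a -> 0 <= d -> d <= 2 * a * (r + 2 * a) ->
  perron_factor g r ->
  [/\ perron_factor (quad a d ^+ k * g) (r + 2 * a * k%:R),
      size (quad a d ^+ k * g) = (k.*2 + size g)%N
    & (('X - (r + 2 * a * k%:R)%:P) * (quad a d ^+ k * g))`_(k.*2 + (size g).-1) =
  (('X - r%:P) * g)`_(size g).-1].
Proof.
move=> a0 d0 dr gg; elim: k => [|k [IHg IHs IHc]].
  by rewrite expr0 mul1r mulr0 addr0.
rewrite exprS -mulrA.
have -> : r + 2 * a * k.+1%:R = r + 2 * a * k%:R + 2 * a by rewrite -natr1; ring.
have dk : d <= 2 * a * (r + 2 * a * k%:R + 2 * a).
  apply: le_trans dr _; rewrite ler_wpM2l ?mulr_ge0 // lerD2r lerDl.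
  by rewrite !mulr_ge0.
have [gs cs] := perron_factor_quadM a0 d0 dk IHg.
have [mg _ _] := IHg; have [mg0 _ _] := gg.
have sg : (0 < size g)%N by rewrite size_poly_gt0 monic_neq0.
split=> //; first by rewrite size_quadM // IHs doubleS.
rewrite -IHc; have := cs; rewrite IHs; case: (size g) sg => // n _ /=.
by rewrite !addnS doubleS /= !addSn.
Qed.

Lemma perron_factor1 r : 0 <= r -> perron_factor 1 r.
Proof.
move=> r0; split; first exact: monic1.
  by move=> i; rewrite coef1; case: eqP.
move=> i; rewrite size_poly1 ltnS leqn0 => /eqP->.
by rewrite mulr1 coefB coefX coefC sub0r oppr_le0.
Qed.

(** The hypotheses on c and d say that the coefficients of X^3 and X^2 in
(X - r) q (X + c) are nonpositive.  That of X is
d (c - r) - 2 a c r, which is nonpositive because c <= r. *)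
Lemma perron_factor_quad_linear a c d r :
  0 <= a -> 0 <= d -> 0 <= c -> c <= r - 2 * a ->
  d <= c * (r - 2 * a) + 2 * a * r -> perron_factor (quad a d * ('X + c%:P)) r.
Proof.
move=> a0 d0 c0 cr dcr.
have sXc : size ('X + c%:P) = 2%N by rewrite size_XaddC.
have mg : quad a d * ('X + c%:P) \is monic.
  by rewrite monicMl ?monic_quad // monicXaddC.
have gE i : (quad a d * ('X + c%:P))`_i =
    nth 0 [:: d * c; d + 2 * a * c; 2 * a + c; 1] i.
  rewrite quad_coef !coefD !coefX !coefC.
  by case: i => [|[|[|[|i]]]] /=; rewrite ?nth_nil //=; ring.
split=> //.
  move=> i; rewrite gE; case: i => [|[|[|[|i]]]] /=; rewrite ?nth_nil //;
    rewrite ?addr_ge0 ?mulr_ge0 //.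
move=> i; rewrite size_quadM ?monicXaddC // sXc mulrBl coefB coefXM coefCM !gE.
have r0 : 0 <= r by nra.
have dc : 0 <= d * c by rewrite mulr_ge0.
have ac : 0 <= a * c by rewrite mulr_ge0.
have rdc : 0 <= r * (d * c) by rewrite mulr_ge0.
have rac : 0 <= r * (a * c) by rewrite mulr_ge0.
have cdr : d * c <= d * r by rewrite ler_wpM2l //; nra.
by case: i => [|[|[|[|i]]]] //= _; nra.
Qed.

(** * Assembling a nonnegative matrix from the list of block sizes *)
Definition realized r (x : sqmx K) := exists N (M : 'M[K]_N), perron_split M r (projT2 x).

Definition quadblock a d k : sqmx K := sqmx_of (companion k.*2 (quad a d ^+ k)).

(** Each k in T glues the companion matrix of (X - r' - 2 a k) q^k to a matrix
with eigenvalue r'.  The trace of the former is r', as the real parts of the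
roots of q^k add up to -2 a k. *)
Lemma realized_glue a d r x T : 0 <= a -> 0 <= d -> 0 < r ->
  d <= 2 * a * (r + 2 * a) -> realized r x ->
  realized (r + 2 * a * (sumn T)%:R) (foldr (@dsum2 K) x (map (quadblock a d) T)).
Proof.
move=> a0 d0 r0 dr rx; elim: T => [|k T [N [M IH]]] /=.
  by rewrite mulr0 addr0.
rewrite natrD; set r1 := r + _ in IH.
have -> : r + 2 * a * (k%:R + (sumn T)%:R) = r1 + 2 * a * k%:R by rewrite /r1; ring.
have le_r : r <= r1 by rewrite lerDl !mulr_ge0.
have r10 : 0 < r1 by apply: lt_le_trans le_r.
have dr1 : d <= 2 * a * (r1 + 2 * a).
  by apply: le_trans dr _; rewrite ler_wpM2l ?mulr_ge0 // lerD2r.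
have [gk sk ck] := perron_factor_quad_exp k a0 d0 dr1 (perron_factor1 (ltW r10)).
rewrite mulr1 size_poly1 addn1 addn0 mulr1 coefB coefX coefC sub0r in gk sk ck.
apply: (perron_factor_glue IH gk _ sk ck).
by rewrite ltr_wpDr // !mulr_ge0.
Qed.

Lemma nonneg_real_form a c d r k T : 0 <= a -> 0 <= d -> 0 <= c ->
  0 < r -> c <= r - 2 * a -> d <= c * (r - 2 * a) + 2 * a * r ->
  d <= 2 * a * (r + 2 * a) ->
  exists N (M : 'M[K]_N), mx_ge0 M /\
   sqsim (sqmx_of M) (dsum (sqmx_of ((r + 2 * a * (k + sumn T)%:R)%:M : 'M_1)
     :: sqmx_of (companion (k.+1.*2 + 1) (quad a d ^+ k.+1 * ('X + c%:P)))
     :: map (quadblock a d) T)).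
Proof.
move=> a0 d0 c0 r0 cr dcr dr.
have gb := perron_factor_quad_linear a0 d0 c0 cr dcr.
have [gk sk _] := perron_factor_quad_exp k a0 d0 dr gb.
rewrite mulrA -exprSr size_quadM ?monicXaddC // size_XaddC in gk sk.
pose r1 := r + 2 * a * k%:R.
have le_r : r <= r1 by rewrite lerDl !mulr_ge0.
have r10 : 0 < r1 by apply: lt_le_trans le_r.
have dr1 : d <= 2 * a * (r1 + 2 * a).
  by apply: le_trans dr _; rewrite ler_wpM2l ?mulr_ge0 // lerD2r.
have sk' : size (quad a d ^+ k.+1 * ('X + c%:P)) = (k.+1.*2 + 1).+1.
  by rewrite sk doubleS -[_.+2]/4%N addn1 !addnS addn0.
have R1 : realized r1
    (sqmx_of (companion (k.+1.*2 + 1) (quad a d ^+ k.+1 * ('X + c%:P)))).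
  by eexists; eexists; apply: (perron_factor_split gk r10 sk').
have [N [M MP]] := realized_glue T a0 d0 r10 dr1 R1.
exists N, M; split; first by case: MP => s [t [P [Q [[]]]]].
have -> : r + 2 * a * (k + sumn T)%:R = r1 + 2 * a * (sumn T)%:R.
  by rewrite /r1 natrD; ring.
have Ms : sqsim (sqmx_of M) (dsum2 (sqmx_of (_ : 'M_1)) (foldr _ _ _)) :=
  perron_split_mxsim MP.
apply: sqsim_trans Ms _; apply: dsum2_sim; first exact: sqsim_refl.
exact: foldr_dsum2.
Qed.

End Build.

(** * Extension of scalars to the complex numbers *)
Section Map.
Variables (F F' : fieldType) (f : {rmorphism F -> F'}).

Lemma mxsim_map m n (A : 'M[F]_m) (B : 'M[F]_n) :
  mxsim A B -> mxsim (map_mx f A) (map_mx f B).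
Proof.
case=> P [Q [PQ QP AP]]; exists (map_mx f P), (map_mx f Q).
by rewrite -!map_mxM PQ QP AP !map_mx1.
Qed.

Lemma map_companion n (p : {poly F}) :
  map_mx f (companion n p) = companion n (map_poly f p).
Proof.
apply/matrixP => i j; rewrite !mxE -coef_map map_modp rmorphM /=.
by rewrite map_polyX map_polyXn.
Qed.

Definition sqmap (x : sqmx F) : sqmx F' := sqmx_of (map_mx f (projT2 x)).

Lemma sqsim_map x y : sqsim x y -> sqsim (sqmap x) (sqmap y).
Proof. exact: mxsim_map. Qed.

Lemma sqmap_dsum s : sqmap (dsum s) = dsum (map sqmap s).
Proof.
elim: s => [|x s IHs] /=; first by rewrite /sqmap /= map_mx0.
by rewrite -IHs /sqmap /dsum2 /= map_block_mx !map_mx0.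
Qed.

End Map.

Definition jblock (F : fieldType) (x : nat * F) : sqmx F :=
  sqmx_of (jordan_block x.1 x.2).

Section Complex.
Variable R : realType.
Implicit Types (a b c d r : R).

Lemma map_quad a b :
  map_poly (real_complex R) (quad a (a ^+ 2 + b ^+ 2)) =
  ('X - ((- a) +i* b)%:P) * ('X - ((- a) -i* b)%:P).
Proof.
rewrite /quad 2!rmorphD /= map_polyXn map_polyZ map_polyX map_polyC /=.
have -> : (2 * a)%:C = - (((- a) +i* b) + ((- a) -i* b)).
  by apply/eqP; rewrite eq_complex /=; apply/andP; split; apply/eqP; ring.
have -> : (a ^+ 2 + b ^+ 2)%:C = ((- a) +i* b) * ((- a) -i* b).
  by apply/eqP; rewrite eq_complex /=; apply/andP; split; apply/eqP; ring.
rewrite -mul_polyC; ring.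
Qed.

Lemma coprime_conj a b m n : 0 < b ->
  coprimep (('X - ((- a) +i* b)%:P) ^+ m) (('X - ((- a) -i* b)%:P) ^+ n).
Proof.
move=> b0; rewrite coprimep_expl // coprimep_expr // coprimep_XsubC root_XsubC.
by rewrite eq_complex /= negb_and; apply/orP; right; lra.
Qed.

Lemma quad_power_jordan a b k : 0 < b ->
  sqsim (sqmap (real_complex R) (quadblock a (a ^+ 2 + b ^+ 2) k))
    (dsum [:: jblock (k, (- a) +i* b); jblock (k, (- a) -i* b)]).
Proof.
move=> b0; rewrite /sqmap /= map_companion rmorphXn /= map_quad exprMn.
have Xz m w := @size_exp_XsubC R[i] m w.
apply: (@sqsim_trans _ (dsum2 (sqmx_of (companion k (('X - ((- a) +i* b)%:P) ^+ k)))
  (sqmx_of (companion k (('X - ((- a) -i* b)%:P) ^+ k))))).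
  by rewrite /sqsim /= -addnn; apply: mxsim_crt; rewrite ?Xz //; apply: coprime_conj.
apply: dsum2_sim; first exact: companion_jordan.
by apply: sqsim_trans (dsum20 _); apply: companion_jordan.
Qed.

Lemma base_jordan a b c k : 0 < b ->
  sqsim (sqmap (real_complex R) (sqmx_of (companion (k.*2 + 1)
          (quad a (a ^+ 2 + b ^+ 2) ^+ k * ('X + c%:P)))))
    (dsum [:: jblock (k, (- a) +i* b); jblock (k, (- a) -i* b);
              jblock (1%N, (- c)%:C)]).
Proof.
move=> b0; have J := quad_power_jordan a k b0.
have sq2 : size (map_poly (real_complex R) (quad a (a ^+ 2 + b ^+ 2)) ^+ k) = k.*2.+1.
  rewrite map_quad exprMn size_mul ?expf_neq0 ?polyXsubC_eq0 //.
  by rewrite !size_exp_XsubC addSn addnS /= addnn.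
have Xc : map_poly (real_complex R) ('X + c%:P) = 'X - (- c)%:C%:P.
  by rewrite rmorphD /= map_polyX map_polyC rmorphN /= polyCN opprK.
have cop : coprimep (map_poly (real_complex R) (quad a (a ^+ 2 + b ^+ 2)) ^+ k)
   ('X - (- c)%:C%:P).
  rewrite map_quad coprimep_expl // coprimep_XsubC rootM !root_XsubC.
  by rewrite !eq_complex /= negb_or !negb_and; apply/andP; split; apply/orP; right; lra.
apply: (@sqsim_trans _ (dsum2
  (sqmap (real_complex R) (quadblock a (a ^+ 2 + b ^+ 2) k))
  (sqmx_of (companion 1 ('X - (- c)%:C%:P))))).
  rewrite /sqsim /= !map_companion !rmorphM /= Xc !rmorphXn /=.
  by apply: mxsim_crt; rewrite ?size_XsubC.
apply: sqsim_trans (dsum2_sim J (sqsim_refl _)) _.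
apply: sqsim_trans (sqsim_sym (dsum_cat [:: _; _] [:: _])).
apply: dsum2_sim; first exact: sqsim_refl.
by apply: sqsim_trans (dsum20 _); apply: (companion_jordan 1).
Qed.

Lemma nonneg_complex_form a b c r k T : 0 <= a -> 0 < b -> 0 <= c ->
  0 < r -> c <= r - 2 * a ->
  a ^+ 2 + b ^+ 2 <= c * (r - 2 * a) + 2 * a * r ->
  a ^+ 2 + b ^+ 2 <= 2 * a * (r + 2 * a) ->
  exists N (M : 'M[R]_N), nonnegative_mx M /\
   sqsim (sqmx_of (complexify M)) (dsum (map (@jblock R[i])
     ([:: (1%N, (r + 2 * a * (k + sumn T)%:R)%:C); (1%N, (- c)%:C)] ++
      flatten [seq [:: (p, (- a) +i* b); (p, (- a) -i* b)] | p <- k.+1 :: T]))).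
Proof.
move=> a0 b0 c0 r0 cr dcr dr.
have d0 : 0 <= a ^+ 2 + b ^+ 2 by rewrite addr_ge0 // sqr_ge0.
have [N [M [M0 MJ]]] := nonneg_real_form k T a0 d0 c0 r0 cr dcr dr.
exists N, M; split=> //; set r' := r + _ in MJ *.
have := sqsim_map (real_complex R) MJ; rewrite sqmap_dsum => MJ'.
pose z := (- a) +i* b; pose zb := (- a) -i* b.
pose ss := [:: (1%N, r'%:C)] :: [:: (k.+1, z); (k.+1, zb); (1%N, (- c)%:C)]
   :: [seq [:: (p, z); (p, zb)] | p <- T].
apply: (@sqsim_trans _ (dsum (map (@jblock R[i]) (flatten ss)))); last first.
  apply: dsum_map_perm; rewrite /ss /= perm_cons.
  by rewrite -[X in perm_eq _ X](cat1s (1%N, _)) perm_sym (perm_catCA [:: _] [:: _; _] _).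
rewrite map_flatten; apply: sqsim_trans _ (sqsim_sym (dsum_flatten _)).
rewrite -map_comp /=.
apply: (@sqsim_trans _ _ _ _ MJ').
apply: dsum2_sim.
  apply: sqsim_trans (dsum20 _); rewrite /sqmap /=.
  suff -> : map_mx (real_complex R) r'%:M = jordan_block 1 r'%:C by apply: mxsim_refl.
  by apply/matrixP => i j; rewrite !ord1 !mxE.
apply: dsum2_sim; first exact: base_jordan.
rewrite -[X in sqsim X _]/(dsum (map (sqmap _) (map _ T))) -!map_comp.
apply: dsum_map_sim => p _ /=.
exact: quad_power_jordan.
Qed.

End Complex.

(** * The block sizes of a Jordan matrix *)

(** The differences of these sums for consecutive k count the terms greater than
k, and the differences of these counts give the multiplicities. *)
Lemma perm_min_sums (s t : seq nat) : all (leq 1) s -> all (leq 1) t ->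
  (forall k, \sum_(p <- s) minn p k = \sum_(p <- t) minn p k)%N ->
  perm_eq s t.
Proof.
move=> s0 t0 st.
have minS (u : seq nat) k : (\sum_(p <- u) minn p k.+1 =
    \sum_(p <- u) minn p k + count (fun p => k < p) u)%N.
  by elim: u => [|p u IHu]; rewrite ?big_nil ?big_cons //= IHu; lia.
have gtst k : count (fun p => k < p)%N s = count (fun p => k < p)%N t.
  by have := st k.+1; rewrite !minS st => /addnI.
have cnt (u : seq nat) k : (count (fun p => k < p) u =
    count_mem k.+1 u + count (fun p => k.+1 < p) u)%N.
  by elim: u => [|p u IHu] //=; rewrite IHu addnACA; congr addn; lia.
have cnt0 (u : seq nat) : all (leq 1) u -> count_mem 0%N u = 0%N.
  by move/allP=> u0; apply/count_memPn/negP=> /u0.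
apply/allP => -[|k] _ /=; first by rewrite !cnt0.
by have := gtst k; rewrite (cnt s) (cnt t) gtst => /addIn->.
Qed.

Section Classification.
Variable F : fieldType.
Implicit Types (z w : F) (S : seq (nat * F)).

Lemma jordan_dsum n (J : 'M[F]_n) : is_jordan_mx J ->
  exists S, all (fun x => 0 < x.1)%N S /\ sqsim (sqmx_of J) (dsum (map (@jblock F) S)).
Proof.
case=> m [p_ [z [en [p0 ->]]]].
exists [seq (p_ i, z i) | i <- enum 'I_m]; split.
  by apply/allP => _ /mapP[i _ ->] /=.
apply: (@sqsim_trans _ (sqmx_of (\mxdiag_i jordan_block (p_ i) (z i)))).
  exact: mxsim_cast.
by rewrite -map_comp; apply: mxdiag_dsum.
Qed.

Lemma jordan_trig p z : is_trig_mx (jordan_block p z)^T.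
Proof.
apply/is_trig_mxP => i j lt_ij; rewrite !mxE -val_eqE /= gtn_eqF //.
by rewrite ltn_eqF // ltnS ltnW.
Qed.

Lemma det_jordan p z : \det (jordan_block p z) = z ^+ p.
Proof.
rewrite -det_tr (det_trig (jordan_trig p z)) -[p in RHS]card_ord -prodr_const.
by apply: eq_bigr => i _; rewrite !mxE eqxx.
Qed.

Lemma char_poly_jordan p z : char_poly (jordan_block p z) = ('X - z%:P) ^+ p.
Proof.
have -> : char_poly (jordan_block p z) = char_poly (jordan_block p z)^T.
  rewrite /char_poly -det_tr; congr (\det _).
  by rewrite /char_poly_mx linearB /= tr_scalar_mx map_trmx.
rewrite (char_poly_trig (jordan_trig p z)) -[p in RHS]card_ord -prodr_const.
by apply: eq_bigr => i _; rewrite !mxE eqxx.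
Qed.

Lemma char_poly_dsum S : char_poly (projT2 (dsum (map (@jblock F) S))) =
  \prod_(w <- flatten [seq nseq x.1 x.2 | x <- S]) ('X - w%:P).
Proof.
elim: S => [|[p z] S IHS] /=; first by rewrite big_nil /char_poly det_mx00.
rewrite /char_poly char_block_diag_mx det_ublock -!/(char_poly _) IHS.
by rewrite char_poly_jordan big_cat /= big_nseq iter_mulr_1.
Qed.

Lemma shift_exp p k :
  jordan_block p (0 : F) ^+ k = \matrix_(i, j) (j == (i + k)%N :> nat)%:R.
Proof.
elim: k => [|k IHk].
  apply/matrixP => i j; rewrite expr0 -[1]/(1%:M) !mxE addn0 eq_sym.
  by rewrite -val_eqE.
rewrite exprSr -mulmxE IHk; apply/matrixP => i j; rewrite !mxE.
have [lt|ge] := ltnP (i + k) p.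
  rewrite (bigD1 (Ordinal lt)) //= big1 => [|l nl]; rewrite !mxE ?eqxx /=.
    rewrite addr0 mul1r -val_eqE /= addnS; case: eqP => [<-|_].
      by rewrite ltn_eqF.
    by case: eqP.
  by move: nl; rewrite -val_eqE /= => /negPf->; rewrite mul0r.
rewrite big1 => [|l _]; last first.
  by rewrite !mxE ltn_eqF ?mul0r // (leq_trans (ltn_ord l)).
by rewrite ltn_eqF // addnS ltnS (leq_trans _ ge) // ltnW.
Qed.

Lemma rank_shift_exp p k : \rank (jordan_block p (0 : F) ^+ k) = (p - k)%N.
Proof.
(* The k-th power of the shift sends the first p - k coordinates to the last
   p - k ones, so it factors through a space of dimension p - k. *)
rewrite shift_exp.
pose L : 'M[F]_(p - k, p) := \matrix_(i, j) (j == i :> nat)%:R.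
pose U : 'M[F]_(p - k, p) := \matrix_(i, j) (j == (i + k)%N :> nat)%:R.
have -> : \matrix_(i, j) (j == (i + k)%N :> nat)%:R = L^T *m U :> 'M[F]_p.
  apply/matrixP => i j; rewrite !mxE.
  have [lt|ge] := ltnP i (p - k).
    rewrite (bigD1 (Ordinal lt)) //= big1 => [|l nl]; rewrite !mxE /= ?eqxx.
      by rewrite addr0 mul1r.
    by move: nl; rewrite -val_eqE /= eq_sym => /negPf->; rewrite mul0r.
  rewrite big1 => [|l _]; first by have := ltn_ord j; case: eqP => //; lia.
  by rewrite !mxE; have := ltn_ord l; case: eqP; rewrite ?mul0r //; lia.
have fr (f : 'I_(p - k) -> nat) (fl : forall i, (f i < p)%N) : injective f ->
   row_free (\matrix_(i, j) (j == f i :> nat)%:R : 'M[F]_(p - k, p)).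
  move=> fi; apply/row_freeP; exists (\matrix_(i, j) (i == f j :> nat)%:R).
  apply/matrixP => i j; rewrite !mxE (bigD1 (Ordinal (fl i))) //= big1 => [|l nl].
    by rewrite !mxE /= eqxx mul1r addr0 (inj_eq fi).
  by move: nl; rewrite !mxE -val_eqE /= => /negPf->; rewrite mul0r.
rewrite mxrankMfree; last first.
  apply: (fr (fun i => (i + k)%N)) => [i|i j /addIn /val_inj//].
  by have := ltn_ord i; lia.
rewrite mxrank_tr; apply/eqP; apply: (fr val) => [i|]; last exact: val_inj.
by have := ltn_ord i; rewrite /=; lia.
Qed.

Lemma rank_jordan_exp p z w k :
  (\rank ((jordan_block p z - w%:M) ^+ k) + (if z == w then minn p k else 0) = p)%N.
Proof.
have -> : jordan_block p z - w%:M = jordan_block p (z - w).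
  apply/matrixP => i j; rewrite !mxE; case: eqP => // _.
  by rewrite mulr0n subr0.
case: eqP => [->|/eqP zw]; first by rewrite subrr rank_shift_exp; lia.
rewrite addn0; apply: mxrank_unit; elim: k => [|k IHk].
  by rewrite expr0; apply: unitmx1.
rewrite exprS -mulmxE unitmx_mul IHk andbT unitmxE.
by rewrite det_jordan unitfE expf_neq0 // subr_eq0.
Qed.

(** Only the blocks at w contribute to the kernel of (A - w)^k, each with the
minimum of its size and k.  With perm_min_sums, these ranks determine the sizes of
the blocks at w. *)
Lemma rank_dsum_exp S w k :
  (\rank ((projT2 (dsum (map (@jblock F) S)) - w%:M) ^+ k) +
    \sum_(p <- [seq x.1 | x <- S & x.2 == w]) minn p k = sumn (map fst S))%N.
Proof.
elim: S => [|[p z] S IHS]; first by rewrite [_ ^+ k]flatmx0 mxrank0 big_nil.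
have exp_block m n (A : 'M[F]_m) (B : 'M[F]_n) :
    block_mx A 0 0 B ^+ k = block_mx (A ^+ k) 0 0 (B ^+ k).
  elim: k {IHS} => [|k IHk]; first by rewrite !expr0 -!/(1%:M) -scalar_mx_block.
  by rewrite !exprS -!mulmxE IHk mulmx_block !(mulmx0, mul0mx, addr0, add0r).
rewrite /= scalar_mx_block opp_block_mx add_block_mx !oppr0 !addr0 exp_block.
rewrite rank_diag_block_mx.
have := rank_jordan_exp p z w k; rewrite -IHS.
by case: eqP => _ /=; rewrite ?big_cons; lia.
Qed.

End Classification.

Section Sizes.
Variable T : eqType.
Implicit Types (w : T) (S : seq (nat * T)).

Definition sizes S w := [seq x.1 | x <- S & x.2 == w].

Lemma perm_sizes S L : uniq L -> all (fun x => x.2 \in L) S ->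
  perm_eq S (flatten [seq [seq (p, w) | p <- sizes S w] | w <- L]).
Proof.
elim: L S => [|w L IHL] S /=; first by case: S.
case/andP=> wL uL SL; rewrite -(perm_filterC (fun x => x.2 == w) S).
apply: perm_cat.
  rewrite /sizes -map_comp (_ : map _ _ = [seq x <- S | x.2 == w]) //.
  rewrite -[RHS]map_id; apply/eq_in_map => -[p v].
  by rewrite mem_filter /= => /andP[/eqP->].
apply: perm_trans (IHL _ uL _) _.
  apply/allP => x; rewrite mem_filter => /andP[/= nx xS].
  by have := allP SL _ xS; rewrite inE (negPf nx).
rewrite [X in perm_eq X _](_ : _ =
  flatten [seq [seq (p, v) | p <- sizes S v] | v <- L]) //.
congr flatten; apply/eq_in_map => v vL.
congr map; rewrite /sizes -filter_predI; congr map; apply: eq_filter => x /=.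
by case: eqP => // ->; apply/eqP => vw; rewrite -vw vL in wL.
Qed.

Lemma sumn_sizes S w :
  sumn (sizes S w) = count_mem w (flatten [seq nseq x.1 x.2 | x <- S]).
Proof.
elim: S => [|[p v] S IHS] //=; rewrite count_cat count_nseq /= -IHS /sizes /=.
by case: ifP; rewrite /= ?mul1n ?mul0n.
Qed.

Lemma perm_flatten_pairs (U : eqType) (f g : nat -> U) s :
  perm_eq (flatten [seq [:: f p; g p] | p <- s]) (map f s ++ map g s).
Proof.
elim: s => //= p s IHs; rewrite perm_cons perm_sym.
by rewrite -[g p :: map g s]cat1s perm_catCA /= perm_cons perm_sym.
Qed.

End Sizes.

Lemma sumn1_pos s : all (leq 1) s -> sumn s = 1%N -> s = [:: 1%N].
Proof.
case: s => [|p [|q s]] //=; first by rewrite addn0 => _ ->.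
by case/and3P => p0 q0 _; lia.
Qed.

Lemma leq_sumn p s : p \in s -> (p <= sumn s)%N.
Proof.
elim: s => //= q s IHs; rewrite inE => /predU1P[->|/IHs le_ps].
  exact: leq_addr.
exact: leq_trans le_ps (leq_addl _ _).
Qed.

(** For a real matrix A, complex conjugation maps (A - w)^k to (A - w^* )^k, so both
have the same rank for all k. *)
Lemma sizes_conj (R : realType) n (A : 'M[R]_n) (S : seq (nat * R[i])) w :
  all (fun x => 0 < x.1)%N S ->
  sqsim (sqmx_of (complexify A)) (dsum (map (@jblock R[i]) S)) ->
  perm_eq (sizes S w) (sizes S w^*).
Proof.
move=> S0 AS.
have pos v : all (leq 1) (sizes S v).
  apply/allP => _ /mapP[x + ->]; rewrite mem_filter => /andP[_ xS].
  exact: allP S0 _ xS.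
apply: perm_min_sums => // k.
have := rank_dsum_exp S w k; rewrite -[in RHS](rank_dsum_exp S w^* k).
rewrite -!(mxsim_rank_exp _ _ AS).
suff -> : \rank ((complexify A - w^*%:M) ^+ k) = \rank ((complexify A - w%:M) ^+ k).
  by move=> /addnI.
have conjX :
    map_mx (@conjc R) ((complexify A - w%:M) ^+ k) = (complexify A - w^*%:M) ^+ k.
  elim: k => [|k IHk]; first by rewrite !expr0 -[1]/(1%:M) map_mx1.
  rewrite !exprS -!mulmxE map_mxM IHk map_mxB map_scalar_mx; congr ((_ - _) *m _).
  by rewrite /complexify -map_mx_comp; apply: eq_map_mx => x /=; rewrite oppr0.
by rewrite -conjX mxrank_map.
Qed.

Lemma count_Lambda_c (R : realType) n (lam a b c : R) w :
  count_mem w (Lambda_c n lam a b c) = ((lam%:C == w) + ((- c)%:C == w) +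
   ((n - 2) %/ 2) * (((- a) +i* b == w) + ((- a) -i* b == w)))%N.
Proof.
rewrite /Lambda_c /= addnA; congr (_ + _)%N; rewrite /conj_pairs.
by elim: (_ %/ _)%N => //= m ->; rewrite mulSn !addnA.
Qed.

(** * Universal realizability *)
Theorem theorem4p1 (R : realType) (n : nat) (lam a b : R)
  (n_ge4 : (4 <= n)%N) (n_even : ~~ odd n)
  (lam_gt0 : 0 < lam) (a_gt0 : 0 < a) (b_gt0 : 0 < b)
  (s1_gt0 : 0 < s1 (Lambda n lam a b))
  (lam_ge : ((2 * n%:R - 11) * a ^+ 2 + b ^+ 2) / (2 * a) <= lam)
  (c : R) (c_gt0 : 0 < c)
  (c_ge : (2 * a * (n%:R * a - lam) + b ^+ 2 - 7 * a ^+ 2)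
            / (lam - (n%:R - 2) * a) <= c)
  (c_le : c <= lam - (n%:R - 2) * a) :
  universally_realizable (Lambda_c n lam a b c).
Proof.
have tr_gt0 : 0 < lam - (n%:R - 2) * a by apply: lt_le_trans c_le.
have [m nE] : exists m, n = (2 * m.+1 + 2)%N by exists (n./2 - 2)%N; lia.
have mE : ((n - 2) %/ 2)%N = m.+1 by lia.
have nR : n%:R = 2 * m%:R + 4 :> R by rewrite nE natrD natrM -natr1; ring.
rewrite ler_pdivrMr ?mulr_gt0 // in lam_ge.
rewrite ler_pdivrMr // in c_ge.
rewrite nR in lam_ge c_ge c_le.
move=> J [Jj Jsp [A [_ /similar_mxsim AJ]]].
have [S [S0 JS]] := jordan_dsum Jj.
pose z : R[i] := (- a) +i* b; pose zb : R[i] := (- a) -i* b.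
(* Comparing characteristic polynomials: the sizes of the blocks at w add up to
   the multiplicity of w in the list. *)
have cnt w : sumn (sizes S w) = count_mem w (Lambda_c n lam a b c).
  rewrite sumn_sizes; apply/permP/prod_XsubC_eq.
  by rewrite -char_poly_dsum -(mxsim_char_poly JS).
have neq (x y u v : R) : (x != u) || (y != v) -> (x +i* y == u +i* v) = false.
  by move=> h; apply/negbTE; rewrite eq_complex /= negb_and.
have Lneq : [/\ (lam%:C == (- c)%:C) = false, (lam%:C == z) = false,
    (lam%:C == zb) = false, ((- c)%:C == z) = false & ((- c)%:C == zb) = false].
  split; apply: neq; apply/orP; [left|right|right|right|right]; lra.
have zzb : (z == zb) = false by apply: neq; apply/orP; right; lra.
have [e1 e2 e3 e4 e5] := Lneq.
have pos v : all (leq 1) (sizes S v).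
  apply/allP => _ /mapP[x + ->]; rewrite mem_filter => /andP[_ xS].
  exact: allP S0 _ xS.
have Slam : sizes S lam%:C = [:: 1%N].
  apply: sumn1_pos => //; rewrite cnt count_Lambda_c eqxx.
  by rewrite -/z -/zb ![_ == lam%:C]eq_sym e1 e2 e3 muln0.
have Sc : sizes S (- c)%:C = [:: 1%N].
  apply: sumn1_pos => //; rewrite cnt count_Lambda_c eqxx.
  by rewrite -/z -/zb e1 ![_ == (- c)%:C]eq_sym e4 e5 muln0.
have sz : sumn (sizes S z) = m.+1.
  by rewrite cnt count_Lambda_c -/z -/zb e2 e4 eqxx mE [zb == z]eq_sym zzb muln1.
have szb : perm_eq (sizes S zb) (sizes S z).
  rewrite perm_sym (_ : zb = z^*) //.
  by apply: (sizes_conj (A := A)) => //; apply: sqsim_trans JS.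
have SL : perm_eq S (flatten [seq [seq (p, w) | p <- sizes S w] |
    w <- [:: lam%:C; (- c)%:C; z; zb]]).
  apply: perm_sizes; first by rewrite /= !inE e1 e2 e3 e4 e5 zzb.
  apply/allP => x xS.
  have : (0 < count_mem x.2 (Lambda_c n lam a b c))%N.
    rewrite -cnt; apply: leq_trans (allP S0 _ xS) (leq_sumn _).
    by apply: map_f; rewrite mem_filter eqxx.
  rewrite count_Lambda_c !inE -/z -/zb ![_ == x.2]eq_sym.
  by do 4 case: eqP => //=; rewrite muln0.
rewrite /= Slam Sc cats0 /= in SL.
have {}SL : perm_eq S ([:: (1%N, lam%:C); (1%N, (- c)%:C)] ++
     flatten [seq [:: (p, z); (p, zb)] | p <- sizes S z]).
  apply: perm_trans SL _ => /=; rewrite !perm_cons perm_sym.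
  apply: perm_trans (perm_flatten_pairs _ _ _) _; rewrite perm_cat2l.
  by rewrite perm_sym; apply: perm_map.
have := pos z; case Tz : (sizes S z) => [|[|k] T] //; first by rewrite Tz in sz.
move=> _; rewrite Tz /= addSn in sz; case: sz => kT.
(* Here m.+1 pairs are in the list; r is the root left for lambda when only one
   of them is present. *)
pose r := lam - 2 * a * m%:R.
have r_gt0 : 0 < r by rewrite /r; nra.
have c_ler : c <= r - 2 * a by rewrite /r; nra.
have d_le1 : a ^+ 2 + b ^+ 2 <= c * (r - 2 * a) + 2 * a * r by rewrite /r; nra.
have d_le2 : a ^+ 2 + b ^+ 2 <= 2 * a * (r + 2 * a) by rewrite /r; nra.
have [N [M [M0 MJ]]] := nonneg_complex_form k T (ltW a_gt0) b_gt0 (ltW c_gt0)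
  r_gt0 c_ler d_le1 d_le2.
move: MJ; rewrite kT {1}/r subrK -/z -/zb -Tz => MJ.
have MJ' : mxsim (complexify M) J.
  apply: sqsim_trans MJ (sqsim_trans _ (sqsim_sym JS)).
  by apply: dsum_map_perm; rewrite perm_sym.
have eN := mxsim_dim MJ'; subst N.
by exists M; split=> //; split=> //; apply/similar_mxsim.
Qed.
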